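(* Let $1<p<\infty$, let $\mu$ be a measure, and let $Y=L_p(\mu)$ be separable. Let $E$ be a Banach space such that $E^*$ is separable. If $Z$ is a closed subspace of $\mathcal{B}(E,Y)$ containing $\mathcal{F}(E,Y)$, then $Z$ has the UBCP.
   Context: $\mathcal{B}(E,Y)$ is the Banach space of bounded linear operators $E\to Y$ with the operator norm, and $\mathcal{F}(E,Y)$ is its subspace of bounded finite-rank operators. Uniform ball-covering property (UBCP): a Banach space $Z$ with unit sphere $S_Z$ has the UBCP if there exist $r>0$ and a sequence $(z_j)_{j\ge1}$ in $Z$ such that $S_Z\subseteq\bigcup_{j\ge1}B(z_j,r)$ and $r<\inf_{j\ge1}\|z_j\|$, where $B(z,r)$ is the open ball with center $z$ and radius $r$. By convention, if $Z=\{0\}$ (so $S_Z=\emptyset$) the UBCP assertion is regarded as trivially true. *)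

(* Defs.v *)
From HB Require Import structures.
From mathcomp Require Import all_boot all_order all_algebra.
From mathcomp Require Import all_classical all_reals topology normedtype.
From mathcomp Require Import measure measurable_realfun lebesgue_measure.
From mathcomp Require Import lebesgue_integral exp ess_sup_inf hoelder.

Set Implicit Arguments.
Unset Strict Implicit.
Unset Printing Implicit Defensive.

Import Order.TTheory GRing.Theory Num.Theory.
Import numFieldNormedType.Exports.

Local Open Scope classical_set_scope.
Local Open Scope ring_scope.

(* The library provides [LspaceType mu p1], the classes modulo a.e. equality of
   measurable real functions with finite p-norm, as a bare type: the vector
   space operations of [LfunType mu p1] are transported to it, and its norm is
   the p-norm of any representative ([Lspace_norm_class]). *)
Section Lspace_normed.
Context d (T : measurableType d) (R : realType).
Variables (mu : {measure set T -> \bar R}) (p : \bar R) (p1 : (1 <= p)%E).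

Local Notation Lp := (LspaceType mu p1).
Local Notation LF := (LfunType mu p1).
Local Notation Q := {mfun_ mu, T >-> measurableTypeR R}.

HB.instance Definition _ := gen_eqMixin Lp.
HB.instance Definition _ := gen_choiceMixin Lp.

Lemma Lnorm_ae_eq (f g : T -> R) :
  measurable_fun setT f -> measurable_fun setT g -> f = g %[ae mu] ->
  ('N[mu]_p[EFin \o f] = 'N[mu]_p[EFin \o g])%E.
Proof.
move=> mf mg fg; rewrite unlock /Lnorm; case: p p1 => [r r1| |//].
- have mh (h : T -> R) : measurable_fun setT h ->
    measurable_fun setT (fun x => (`|(h x)%:E| `^ r)%E).
    move=> mh; apply/measurable_EFinP.
    apply: (@measurableT_comp _ _ _ _ _ _ (@powR R ^~ r)) => //.
    exact: measurableT_comp.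
  congr (_ `^ _)%E; apply: ae_eq_integral => //=; [exact: mh|exact: mh|].
  by apply: filterS fg => x /= /(_ I) -> _.
- move=> _; case: ifPn => // _; apply: eq_ess_sup.
  by apply: filterS fg => x /= /(_ I) ->.
Qed.

Section Class.
Variable f : LF.

Let f_mfun := isMeasurableFun.Build _ _ T (measurableTypeR R) (f : T -> R)
  (@measurable_funPT _ _ _ _ f).
Let f_mf : {mfun T >-> measurableTypeR R} := HB.pack (f : T -> R) f_mfun.

Let Lclass_quot : Q := (\pi_Q f_mf)%qT.

Let Lclass_quotP : (Lclass_quot : T -> R) = f %[ae mu].
Proof.
have := reprK Lclass_quot.
by rewrite {2}/Lclass_quot => /eqmodP/asboolP.
Qed.

Let Lclass_finite : finite_norm mu p Lclass_quot.
Proof.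
have mq : measurable_fun setT (Lclass_quot : T -> R).
  exact: (@measurable_funPT _ _ _ _ (repr Lclass_quot)).
have mf : measurable_fun setT (f : T -> R) by exact: measurable_funPT.
by rewrite /finite_norm (Lnorm_ae_eq mq mf Lclass_quotP); exact: Lfunction_finite.
Qed.

Definition Lclass : Lp :=
  HB.pack Lclass_quot (isFinLebesgue.Build _ _ _ mu p p1 _ Lclass_finite).

Lemma LclassP : (Lclass : T -> R) = f %[ae mu].
Proof. exact: Lclass_quotP. Qed.

End Class.

Lemma Lspace_inj (f g : Lp) : (f : T -> R) = g %[ae mu] -> f = g.
Proof.
move=> fg.
have : (f : Q) = g.
  rewrite -[LHS]reprK -[RHS]reprK.
  by apply/eqmodP/asboolP.
case: f fg => f [[fp]]; case: g => g [[gp]] /= fg fgE.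
case: _ / fgE in gp fg *.
by rewrite (Prop_irrelevance gp fp).
Qed.

Lemma Lspace_measurable (f : Lp) : measurable_fun setT (f : T -> R).
Proof. exact: (@measurable_funPT _ _ _ _ (repr (f : Q))). Qed.

Lemma Lspace_Lfun (f : Lp) : (f : T -> R) \in Lfun mu p.
Proof.
rewrite inE; apply/andP; split; rewrite inE/=; first exact: Lspace_measurable.
exact: Lebesgue_finite.
Qed.

Definition Lrepr (f : Lp) : LF := Lfun_Sub p1 (Lspace_Lfun f).

Lemma LreprE (f : Lp) : (Lrepr f : T -> R) = f. Proof. by []. Qed.

Let add (f g : Lp) : Lp := Lclass (Lrepr f + Lrepr g).
Let opp (f : Lp) : Lp := Lclass (- Lrepr f).
Let scale (a : R) (f : Lp) : Lp := Lclass (a *: Lrepr f).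
Let zero : Lp := Lclass 0.

Lemma Lclass_eq (f g : LF) : (f : T -> R) = g %[ae mu] -> Lclass f = Lclass g.
Proof.
move=> fg; apply: Lspace_inj; apply: ae_eq_trans (LclassP f) _.
by apply: ae_eq_trans fg _; apply/ae_eq_sym/LclassP.
Qed.

Lemma LreprK : cancel Lrepr Lclass.
Proof. by move=> f; apply: Lspace_inj; exact: LclassP. Qed.

Let addE f g : add (Lclass f) (Lclass g) = Lclass (f + g).
Proof.
apply: Lclass_eq.
have /= := LclassP f; have /= := LclassP g.
by apply: filterS2 => x /= gx fx _; rewrite /= /GRing.add /= fx// gx.
Qed.

Let oppE f : opp (Lclass f) = Lclass (- f).
Proof.
apply: Lclass_eq.
have /= := LclassP f.
by apply: filterS => x /= fx _; rewrite /= /GRing.opp /= fx.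
Qed.

Let scaleE a f : scale a (Lclass f) = Lclass (a *: f).
Proof.
apply: Lclass_eq.
have /= := LclassP f.
by apply: filterS => x /= fx _; rewrite /= /GRing.scale /= fx.
Qed.

Let addA : associative add.
Proof.
move=> f g h; rewrite -(LreprK f) -(LreprK g) -(LreprK h).
by rewrite !addE addrA.
Qed.

Let addC : commutative add.
Proof. by move=> f g; rewrite /add addrC. Qed.

Let add0 : left_id zero add.
Proof. by move=> f; rewrite -(LreprK f) addE add0r. Qed.

Let addN : left_inverse zero opp add.
Proof. by move=> f; rewrite -(LreprK f) oppE addE addNr. Qed.

HB.instance Definition _ := GRing.isZmodule.Build Lp addA addC add0 addN.

Let scaleA a b f : scale a (scale b f) = scale (a * b) f.
Proof. by rewrite -(LreprK f) !scaleE scalerA. Qed.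

Let scale1 : left_id 1 scale.
Proof. by move=> f; rewrite -(LreprK f) scaleE scale1r. Qed.

Let scaleDr : right_distributive scale add.
Proof.
move=> a f g; rewrite -(LreprK f) -(LreprK g).
by rewrite !(addE, scaleE) scalerDr.
Qed.

Let scaleDl f a b : scale (a + b) f = add (scale a f) (scale b f).
Proof. by rewrite -(LreprK f) !(addE, scaleE) scalerDl. Qed.

HB.instance Definition _ := GRing.Zmodule_isLmodule.Build R Lp
  scaleA scale1 scaleDr scaleDl.

Lemma LclassD (f g : LF) : Lclass (f + g) = Lclass f + Lclass g.
Proof. exact/esym/addE. Qed.

Lemma LclassZ a (f : LF) : Lclass (a *: f) = a *: Lclass f.
Proof. exact/esym/scaleE. Qed.

Definition Lspace_norm (f : Lp) : R := fine ('N[mu]_p[EFin \o (f : T -> R)])%E.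

Lemma Lspace_norm_class (f : LF) :
  Lspace_norm (Lclass f) = fine ('N[mu]_p[EFin \o (f : T -> R)])%E.
Proof.
congr fine; apply: Lnorm_ae_eq; [exact: Lspace_measurable| |exact: LclassP].
exact: measurable_funPT.
Qed.

Let normD (f g : Lp) : Lspace_norm (f + g) <= Lspace_norm f + Lspace_norm g.
Proof. by rewrite [f + g]/(add _ _) Lspace_norm_class; exact: ler_LnormD. Qed.

Let normZ a (f : Lp) : Lspace_norm (a *: f) = `|a| * Lspace_norm f.
Proof.
rewrite [a *: f]/(scale _ _) Lspace_norm_class.
apply: EFin_inj; rewrite finite_norm_fine EFinM.
by rewrite (finite_norm_fine (Lrepr f)) -LnormZ.
Qed.

Let norm0_eq0 (f : Lp) : Lspace_norm f = 0 -> f = 0.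
Proof.
move=> /(@fine_Lnormr_eq0 _ _ _ mu p p1 (Lrepr f)) f0.
by rewrite -[f]LreprK; exact: Lclass_eq.
Qed.

HB.instance Definition _ := Lmodule_isNormed.Build R Lp normD normZ norm0_eq0.

Lemma Lspace_normE (f : Lp) :
  `|f| = fine ('N[mu]_p[EFin \o (f : T -> R)])%E.
Proof. by []. Qed.

End Lspace_normed.

Section BoundedOp.
Context (R : realType) (E F : normedModType R).

Definition bounded_linear : set (E -> F) :=
  [set f | linear f /\ exists M : R, forall x, `|f x| <= M * `|x|].

Definition bounded_linear_pred : {pred E -> F} := mem bounded_linear.

Record bounded_op := BoundedOp {
  bounded_op_fun :> E -> F;
  _ : bounded_op_fun \in bounded_linear_pred }.

HB.instance Definition _ := [isSub for bounded_op_fun].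
HB.instance Definition _ := [Choice of bounded_op by <:].

Lemma bounded_linear_submod_closed : submod_closed bounded_linear_pred.
Proof.
split.
  rewrite inE; split; first by move=> a x y; rewrite /= scaler0 addr0.
  by exists 0 => x; rewrite mul0r normr0.
move=> a f g /[!inE] -[lf [Mf bf]] [lg [Mg bg]]; split.
  move=> b x y; rewrite -[LHS]/(a *: f _ + g _) lf lg.
  rewrite -[RHS]/(b *: (a *: f x + g x) + (a *: f y + g y)).
  by rewrite !scalerDr !scalerA (mulrC a) addrACA.
exists (`|a| * Mf + Mg) => x; rewrite mulrDl (le_trans (ler_normD _ _))//.
by rewrite lerD// normrZ -mulrA ler_wpM2l.
Qed.

HB.instance Definition _ := GRing.isSubmodClosed.Build R (E -> F)
  bounded_linear_pred bounded_linear_submod_closed.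
HB.instance Definition _ := [SubChoice_isSubLmodule of bounded_op by <:].

Lemma bounded_op_linear (f : bounded_op) : linear f.
Proof. by have := valP f; rewrite inE => -[]. Qed.

Lemma bounded_op_bounded (f : bounded_op) :
  exists M : R, forall x, `|f x| <= M * `|x|.
Proof. by have := valP f; rewrite inE => -[]. Qed.

Lemma bounded_opP (f g : bounded_op) : f =1 g -> f = g.
Proof. by move=> fg; apply/val_inj/funext. Qed.

Definition opnorm (f : bounded_op) : R :=
  sup [set `|f x| | x in [set x : E | `|x| <= 1]].

Let f0 (f : bounded_op) : f 0 = 0.
Proof. by have := bounded_op_linear f (-1) 0 0; rewrite !scaleN1r !addNr. Qed.

Let fZ (f : bounded_op) a x : f (a *: x) = a *: f x.
Proof. by have := bounded_op_linear f a x 0; rewrite f0 !addr0. Qed.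

Let opnorm_has_sup (f : bounded_op) :
  has_sup [set `|f x| | x in [set x : E | `|x| <= 1]].
Proof.
split; first by exists `|f 0|, 0 => //=; rewrite normr0.
have [M fM] := bounded_op_bounded f; exists `|M| => _ [x /= x1 <-].
rewrite (le_trans (fM x))// (le_trans (ler_wpM2r _ (ler_norm M)))//.
by rewrite ler_piMr.
Qed.

Lemma opnorm_ub (f : bounded_op) x : `|x| <= 1 -> `|f x| <= opnorm f.
Proof.
by move=> x1; apply: ub_le_sup; [exact: (opnorm_has_sup f).2|exists x].
Qed.

Lemma opnorm_le (f : bounded_op) M : (forall x, `|x| <= 1 -> `|f x| <= M) ->
  opnorm f <= M.
Proof.
move=> fM; apply: ge_sup; first exact: (opnorm_has_sup f).1.
by move=> _ [x x1 <-]; exact: fM.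
Qed.

Lemma opnormD (f g : bounded_op) : opnorm (f + g) <= opnorm f + opnorm g.
Proof.
apply: opnorm_le => x x1; rewrite (le_trans (ler_normD _ _))//.
by rewrite lerD// opnorm_ub.
Qed.

Let opnormZ_le a (f : bounded_op) : opnorm (a *: f) <= `|a| * opnorm f.
Proof.
apply: opnorm_le => x x1; rewrite [(a *: f) x]/(a *: f x) normrZ.
by rewrite ler_wpM2l// opnorm_ub.
Qed.

Lemma opnormZ a (f : bounded_op) : opnorm (a *: f) = `|a| * opnorm f.
Proof.
apply/eqP; rewrite eq_le opnormZ_le/=.
have [->|a0] := eqVneq a 0.
  rewrite normr0 mul0r; apply: le_trans (opnorm_ub _ (x := 0) _) => //.
  by rewrite normr0.
rewrite -ler_pdivlMl ?normr_gt0// -normfV.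
by rewrite -{1}[f](@scalerK _ _ a)// unitfE.
Qed.

Lemma opnorm0_eq0 (f : bounded_op) : opnorm f = 0 -> f = 0.
Proof.
move=> f_0; apply: bounded_opP => x.
have [->|x0] := eqVneq x 0; first by rewrite f0.
have nx0 : `|x| != 0 by rewrite normr_eq0.
have : `|f (`|x|^-1 *: x)| <= 0.
  by rewrite -f_0 opnorm_ub// normrZ normfV normr_id mulVf.
rewrite normr_le0 fZ scaler_eq0 invr_eq0 (negbTE nx0)/= => /eqP ->.
by [].
Qed.

HB.instance Definition _ :=
  Lmodule_isNormed.Build R bounded_op opnormD opnormZ opnorm0_eq0.

Lemma bounded_op_normE (f : bounded_op) :
  `|f| = sup [set `|f x| | x in [set x : E | `|x| <= 1]].
Proof. by []. Qed.

(* The range lies in the span of finitely many vectors. *)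
Definition finite_rank : set bounded_op :=
  [set f | exists (n : nat) (v : 'I_n -> F),
    forall x, exists c : 'I_n -> R, f x = \sum_(i < n) c i *: v i].

End BoundedOp.

Definition dual (R : realType) (E : normedModType R) := bounded_op E R^o.
HB.instance Definition _ (R : realType) (E : normedModType R) :=
  NormedModule.on (dual E).

Definition separable (X : topologicalType) : Prop :=
  exists2 D : set X, countable D & dense D.

(* [Z] is meant to be a linear subspace of [V] with the inherited norm: the
   centers and the covered points range over [Z], so that intersecting the
   balls of [V] with [Z] gives the balls of [Z]. The first disjunct is the
   convention for the zero space, whose unit sphere is empty. *)
Definition UBCP (R : realType) (V : normedModType R) (Z : set V) : Prop :=
  Z = [set 0] \/
  exists (r : R) (z : nat -> V),
    [/\ 0 < r,
        forall j, Z (z j),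
        Z `&` [set x | `|x| = 1] `<=` \bigcup_j ball (z j) r &
        r < inf (range (fun j => `|z j|))].

(* Main.v *)
Require Import Defs.
From mathcomp Require Import all_boot all_order all_algebra.
From mathcomp Require Import all_classical all_reals topology normedtype.
From mathcomp Require Import measure hoelder.
From mathcomp Require Import sequences exp measurable_realfun lebesgue_measure.
From mathcomp Require Import lebesgue_integral ring lra.

(** The theorem holds for every separable uniformly smooth space Y in place of
    L_p, and the covering balls can be centered at operators of rank one.

    Let y be a unit vector of Y, let phi be a functional of norm 1 with
    phi y = 1, and let t be large. The operator u |-> u - t phi(u) y has norm
    at most t - 1/2 ([rank_one_reflection]): a unit vector u splits as g + a y
    with phi g = 0 and `|a| <= 1, and u - t a y is, for a >= 0, a convex
    combination of g, which has norm at most 2, and of g - (t - 1) y, which is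
    a vector of length about t - 1 perturbed in a direction tangent to the
    sphere; by uniform smoothness the perturbation adds at most 1/2 to the
    length.

    Given an operator f of norm 1, choose a unit vector x with `|f x| almost 1
    and let y be f x, normalized. The rank-one operator S : u |-> t phi(f u) y
    then satisfies `|f - S| <= t - 1/2 by the previous paragraph, while `|S| is
    almost t. The gap 1/2 does not depend on f, which leaves room to replace S
    by a member of a countable family: rank-one operators depend continuously
    on the functional in the dual of E and on the vector in Y, and both spaces
    are separable ([UBCP_uniformly_smooth]).

    Two ingredients remain. The functional phi is the derivative of the norm
    at y: the infimum over s > 0 of (`|y + s u| - 1) / s is a sublinear
    function of u, and smoothness makes it odd, hence linear
    ([norm_deriv_linear]). The uniform smoothness of L_p for 1 < p < oo
    ([Lspace_uniformly_smooth]) comes from integrating a scalar inequality: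
    `|a + s b|^p + `|a - s b|^p exceeds 2 `|a|^p by at most
    s eta (`|a|^p + `|b|^p) once s is small in terms of p and eta
    ([powR_two_point]). *)

Import Order.TTheory GRing.Theory Num.Theory.
Import numFieldNormedType.Exports.

Local Open Scope classical_set_scope.
Local Open Scope ring_scope.

(** * The scalar two-point inequality *)

(** From [expR y <= (1 - y)^-1], which turns the sum into 2 / (1 - x^2). *)
Lemma expR_cosh_le {R : realType} (x : R) :
  `|x| <= 2^-1 -> expR x + expR (- x) <= 2 + 4 * x ^+ 2.
Proof.
rewrite ler_norml => /andP[x_ge x_le].
have expR_le (y : R) : y < 1 -> expR y <= (1 - y)^-1.
  move=> y1; rewrite -[y in expR y]opprK expRN.
  rewrite lef_pV2 ?posrE ?expR_gt0 ?subr_gt0//.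
  exact: expR_ge1Dx.
apply: (@le_trans _ _ ((1 - x)^-1 + (1 + x)^-1)).
  by rewrite lerD//; [apply: expR_le|rewrite -{2}(opprK x) expR_le]; lra.
have -> : (1 - x)^-1 + (1 + x)^-1 = 2 / (1 - x ^+ 2).
  by field; apply/and3P; split; apply/lt0r_neq0; nra.
have x2 : x ^+ 2 <= 4^-1 by nra.
have := sqr_ge0 x; set y := x ^+ 2 in x2 *; move=> y_ge0.
by rewrite ler_pdivrMr; nra.
Qed.

(** The terms of first order in z cancel, so that the excess over 2 is
    quadratic: 1 + z is bounded by the exponential of z, and the sum by
    2 cosh (p z). *)
Lemma powR_two_point_small {R : realType} (p eta : R) : 1 < p -> 0 < eta ->
  exists2 delta : R, 0 < delta & forall z : R, `|z| <= delta ->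
    `|1 + z| `^ p + `|1 - z| `^ p <= 2 + eta * `|z|.
Proof.
move=> p1 eta0; have p0 : 0 < p by lra.
have powR_le_expR (z : R) : `|z| <= 1 -> `|1 + z| `^ p <= expR (p * z).
  rewrite ler_norml => /andP[z_ge _].
  rewrite mulrC expRM ge0_ler_powR ?nnegrE ?expR_ge0 ?normr_ge0 ?(ltW p0)//.
  by rewrite ger0_norm ?expR_ge1Dx//; lra.
exists (Num.min (2 * p)^-1 (eta / (4 * p ^+ 2))).
  by rewrite lt_min invr_gt0 divr_gt0 ?mulr_gt0 ?exprn_gt0.
move=> z; rewrite le_min => /andP[].
rewrite invfM -ler_pdivrMr ?invr_gt0// invrK => z_p.
rewrite ler_pdivlMr ?mulr_gt0 ?exprn_gt0// => z_eta.
have pz : `|p * z| <= 2^-1 by rewrite normrM (gtr0_norm p0) mulrC.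
have z1 : `|z| <= 1 by have := normr_ge0 z; nra.
apply: (@le_trans _ _ (expR (p * z) + expR (- (p * z)))).
  by rewrite lerD ?powR_le_expR// -mulrN powR_le_expR// normrN.
rewrite (le_trans (expR_cosh_le _ pz))// lerD2l exprMn.
rewrite -(real_normK (num_real z)).
by have := normr_ge0 z; nra.
Qed.

(** After division by `|a|^p only b / a matters. When s b is small with respect
    to a, this is the quadratic bound for small z; otherwise all the terms on
    the left are O((s `|b|)^p), and s^p = s * s^(p-1) is negligible with respect
    to s because p > 1. *)
Lemma powR_two_point {R : realType} (p eta : R) : 1 < p -> 0 < eta ->
  exists2 s : R, 0 < s <= 1 & forall a b : R,
    `|a + s * b| `^ p + `|a - s * b| `^ p <=
      (2 + s * eta) * `|a| `^ p + s * eta * `|b| `^ p.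
Proof.
move=> p1 eta0; have p0 : 0 < p by lra.
have [delta delta0 small] := powR_two_point_small _ _ p1 eta0.
pose M := 2 * (1 + delta^-1) `^ p.
have M0 : 0 < M by rewrite mulr_gt0 ?powR_gt0 ?addr_gt0 ?invr_gt0.
(* The constant M is chosen so that M (s `|b|)^p bounds the left-hand side
   when delta `|a| < s `|b|. *)
have [s /andP[s0 s1] sM] : exists2 s : R, 0 < s <= 1 & M * s `^ p <= s * eta.
  exists (Num.min 1 ((eta / M) `^ (p - 1)^-1)).
    by rewrite ge_min lexx lt_min ltr01 powR_gt0 ?divr_gt0.
  set s := Num.min _ _.
  have s0 : 0 < s by rewrite lt_min ltr01 powR_gt0 ?divr_gt0.
  rewrite -(mulr_powRB1 (ltW s0) p0) mulrCA ler_pM2l// mulrC -ler_pdivlMr//.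
  rewrite [leRHS](_ : _ = ((eta / M) `^ (p - 1)^-1) `^ (p - 1)); last first.
    by rewrite -powRrM mulVf ?powRr1 ?divr_ge0 ?ltW//; lra.
  rewrite ge0_ler_powR ?nnegrE ?powR_ge0 ?(ltW s0)//; first lra.
  by rewrite ge_min lexx orbT.
exists s => [|a b]; first by rewrite s0.
have M2 : 2 <= M.
  rewrite ler_pMr// [leLHS](_ : _ = 1 `^ p); last by rewrite powR1.
  rewrite ge0_ler_powR ?nnegrE ?(ltW p0)//.
    by rewrite addr_ge0// invr_ge0 ltW.
  by rewrite lerDl invr_ge0 ltW.
have [->|a_neq0] := eqVneq a 0.
  rewrite add0r sub0r normrN normr0 powR0 ?gt_eqF// mulr0 !add0r.
  rewrite normrM powRM// (gtr0_norm s0).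
  have sp := le_trans (ler_wpM2r (powR_ge0 s p) M2) sM.
  have := ler_wpM2r (powR_ge0 `|b| p) sp.
  lra.
have norm1 c :
    `|1 + s * c| `^ p + `|1 - s * c| `^ p <= 2 + s * eta * (1 + `|c| `^ p).
  have c_ge0 := normr_ge0 c; have cp_ge0 := powR_ge0 `|c| p.
  have [sc|sc] := leP `|s * c| delta.
    rewrite (le_trans (small _ sc))// normrM (gtr0_norm s0) lerD2l mulrCA mulrA.
    rewrite ler_pM2l ?mulr_gt0//.
    have [c1|/ltW c1] := leP `|c| 1; first lra.
    by have := le1r_powR c1 (ltW p1); lra.
  have bound (x : R) : `|x| <= 1 + `|s * c| ->
      `|x| `^ p <= (1 + delta^-1) `^ p * (s `^ p * `|c| `^ p).
    move=> x_le; rewrite -powRM ?(ltW s0)//.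
    rewrite -powRM ?mulr_ge0 ?(ltW s0)//; last first.
      by rewrite addr_ge0 ?invr_ge0 ?ltW.
    rewrite ge0_ler_powR ?nnegrE ?(ltW p0)//.
      by rewrite !mulr_ge0 ?addr_ge0 ?invr_ge0// ltW.
    rewrite -[in leRHS](gtr0_norm s0) -normrM (le_trans x_le)//.
    rewrite mulrDl mul1r addrC lerD2l.
    by rewrite mulrC ler_pdivlMr// mul1r ltW.
  have h1 : `|1 + s * c| <= 1 + `|s * c|.
    by rewrite (le_trans (ler_normD _ _))// normr1.
  have h2 : `|1 - s * c| <= 1 + `|s * c|.
    by rewrite (le_trans (ler_normB _ _))// normr1.
  apply: (le_trans (lerD (bound _ h1) (bound _ h2))).
  have := ler_wpM2r cp_ge0 sM; rewrite /M.
  have : 0 < s * eta by rewrite mulr_gt0.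
  lra.
have a_gt0 : 0 < `|a| by rewrite normr_gt0.
have := norm1 (b / a); rewrite -(ler_pM2l (powR_gt0 p a_gt0)).
have scale (x : R) : `|a| `^ p * `|x| `^ p = `|a * x| `^ p.
  by rewrite normrM powRM.
rewrite !mulrDr !scale !mulrDr mulrN mulr1 !(mulrCA a) mulfV// !mulr1.
rewrite [X in _ <= _ + X -> _](_ : _ =
    s * eta * `|a| `^ p + s * eta * `|b| `^ p).
  by lra.
by rewrite (mulrC (`|a| `^ p)) mulrCA scale mulrCA mulfV// mulr1.
Qed.

(** * Uniform smoothness of the Lebesgue spaces *)

(** The modulus of smoothness of Y is o(s). One scale s for each eps determines
    all smaller ones, because by convexity of the norm
    (`|y + s g| + `|y - s g| - 2) / s is nondecreasing in s. *)
Definition uniformly_smooth {R : realType} (Y : normedModType R) : Prop :=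
  forall eps : R, 0 < eps -> exists2 s : R, 0 < s <= 1 &
    forall y g : Y, `|y| = 1 -> `|g| <= 1 ->
      `|y + s *: g| + `|y - s *: g| <= 2 + eps * s.

(** This is Young's inequality for x and 1. *)
Lemma bernoulli_powR {R : realType} (p x : R) : 1 < p -> 0 <= x ->
  1 + p * (x - 1) <= x `^ p.
Proof.
move=> p1 x0; have p0 : 0 < p by lra.
have := @conjugate_powR _ x 1 p (p / (p - 1)) x0 ler01 p0.
rewrite divr_gt0 ?subr_gt0// powR1 mulr1 => /(_ isT).
have -> : p^-1 + (p / (p - 1))^-1 = 1.
  by field; apply/andP; split; apply/lt0r_neq0; lra.
move=> /(_ erefl); rewrite -(ler_pM2l p0).
have -> : p * (x `^ p / p + 1 / (p / (p - 1))) = x `^ p + p - 1.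
  by field; apply/andP; split; apply/lt0r_neq0; lra.
lra.
Qed.

(** Bernoulli's inequality linearizes both powers at 1; it is what converts a
    bound on p-th powers of norms into a bound on the norms. *)
Lemma powR_sum_le {R : realType} (p x z w : R) : 1 < p -> 0 <= x -> 0 <= z ->
  0 <= w -> x `^ p + z `^ p <= 2 + w -> x + z <= 2 + w.
Proof.
move=> p1 x0 z0 w0 xz_w.
have [xz2|xz2] := leP (x + z) 2; first lra.
have := bernoulli_powR p x p1 x0; have := bernoulli_powR p z p1 z0.
have : 1 * (x + z - 2) <= p * (x + z - 2) by rewrite ler_wpM2r//; lra.
lra.
Qed.

Section LspaceSmooth.
Context {d : measure_display} {T : measurableType d} {R : realType}.
Context (mu : {measure set T -> \bar R}) (p : R).
Context (p1 : (1 <= p%:E)%E).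

(** Stated for the class of a function rather than for a class, because the
    representative of f + s g agrees only almost everywhere with the sum of
    representatives. *)
Lemma Lspace_powR_norm (F : LfunType mu p1) :
  (`|Lclass F| `^ p)%:E = (\int[mu]_x (`|F x| `^ p)%:E)%E.
Proof.
have p0 : p != 0 by rewrite gt_eqF// (lt_le_trans ltr01)// -lee_fin.
rewrite [`|Lclass F|]Lspace_norm_class -poweR_EFin finite_norm_fine.
by rewrite poweR_Lnorm.
Qed.

Let measurable_powR_norm (F : LfunType mu p1) :
  measurable_fun [set: T] (fun x => (`|F x| `^ p)%:E).
Proof.
apply/measurable_EFinP; apply: (measurableT_comp (measurable_powR p)).
by apply: measurableT_comp => //; exact: measurable_funPT.
Qed.

Lemma Lspace_powR_two_point (s c : R) : 0 <= c ->
  (forall a b : R, `|a + s * b| `^ p + `|a - s * b| `^ p <=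
     (2 + c) * `|a| `^ p + c * `|b| `^ p) ->
  forall f g : LspaceType mu p1,
    `|f + s *: g| `^ p + `|f - s *: g| `^ p <=
      (2 + c) * `|f| `^ p + c * `|g| `^ p.
Proof.
move=> c0 two_point f g; rewrite -(LreprK f) -(LreprK g).
move: (Lrepr f) (Lrepr g) => {f g} f g.
rewrite -scaleNr -!LclassZ -!LclassD -lee_fin !(EFinD, EFinM) !Lspace_powR_norm.
have powR_EFin_ge0 (h : LfunType mu p1) x : setT x -> (0 <= (`|h x| `^ p)%:E)%E.
  by rewrite lee_fin powR_ge0.
have c2 : 0 <= 2 + c by rewrite addr_ge0.
rewrite -(ge0_integralD mu measurableT (powR_EFin_ge0 (f + s *: g))
  (measurable_powR_norm _) (powR_EFin_ge0 (f + - s *: g))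
  (measurable_powR_norm _)).
have scaled_ge0 (k : R) (h : LfunType mu p1) : 0 <= k ->
    forall x, setT x -> (0 <= k%:E * (`|h x| `^ p)%:E)%E.
  by move=> k0 x _; rewrite mule_ge0 ?lee_fin ?powR_ge0.
have scaled_measurable (k : R) (h : LfunType mu p1) :
    measurable_fun [set: T] (fun x => (k%:E * (`|h x| `^ p)%:E)%E).
  exact: (measurable_funeM _ (measurable_powR_norm h)).
rewrite -(ge0_integralZl_EFin mu measurableT (powR_EFin_ge0 f)
  (measurable_powR_norm f) c2).
rewrite -(ge0_integralZl_EFin mu measurableT (powR_EFin_ge0 g)
  (measurable_powR_norm g) c0).
rewrite -ge0_integralD//; [|exact: scaled_ge0|exact: scaled_ge0].
apply: ge0_le_integral => //.
- by move=> x _; rewrite adde_ge0// powR_EFin_ge0.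
- by apply: emeasurable_funD; exact: measurable_powR_norm.
- by apply: emeasurable_funD; exact: scaled_measurable.
move=> x _; rewrite -!EFinM -!EFinD lee_fin.
by have := two_point (f x) (g x); rewrite -mulNr.
Qed.

End LspaceSmooth.

(** On unit balls, the two-point inequality gives
    `|f + s g|^p + `|f - s g|^p <= 2 + 2 s eta, hence eta = eps / 2. *)
Lemma Lspace_uniformly_smooth {d : measure_display} {T : measurableType d}
  {R : realType} (mu : {measure set T -> \bar R}) (p : \bar R)
  (p1 : (1 <= p)%E) :
  (1 < p)%E -> (p < +oo)%E -> uniformly_smooth (LspaceType mu p1).
Proof.
case: p p1 => [p p1| |]//; rewrite lte_fin => p_gt1 _ eps eps0.
have [s s01 two_point] :=
  powR_two_point p (eps / 2) p_gt1 (divr_gt0 eps0 (ltr0Sn _ 1)).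
exists s => // f g f1 g1; have /andP[s0 _] := s01.
have c0 : 0 <= s * (eps / 2) by rewrite mulr_ge0 ?divr_ge0 ?ltW.
have gp : `|g| `^ p <= 1.
  rewrite [leRHS](_ : _ = 1 `^ p); last by rewrite powR1.
  by rewrite ge0_ler_powR ?nnegrE//; lra.
apply: (powR_sum_le p) => //; first by rewrite mulr_ge0 ?ltW.
apply: le_trans (Lspace_powR_two_point mu p p1 _ _ c0 two_point f g) _.
rewrite f1 powR1 mulr1 -addrA lerD2l.
rewrite [leRHS](_ : _ = s * (eps / 2) + s * (eps / 2) * 1); last by field.
by rewrite lerD2l ler_wpM2l.
Qed.

(** * The derivative of the norm of a smooth space *)
Section NormingFunctional.
Context {R : realType} {Y : normedModType R} (y : Y).
Context (Ysmooth : uniformly_smooth Y) (y1 : `|y| = 1).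

Let quot (u : Y) (s : R) : R := (`|y + s *: u| - 1) / s.

(** As s decreases to 0 the quotients decrease, by convexity of the norm, to the
    right derivative of the norm at y in the direction u; the infimum is
    therefore that derivative. *)
Definition norm_deriv (u : Y) : R := inf [set quot u s | s in [set s | 0 < s]].

Let quot_ge u s : 0 < s -> - `|u| <= quot u s.
Proof.
move=> s0; rewrite /quot ler_pdivlMr// mulNr.
have := lerB_normD y (s *: u); rewrite y1 normrZ (gtr0_norm s0); lra.
Qed.

Let quot_le u s : 0 < s -> norm_deriv u <= quot u s.
Proof.
move=> s0; apply: ge_inf; last by exists s.
by exists (- `|u|) => _ [r r0 <-]; exact: quot_ge.
Qed.

Let le_norm_deriv u m : (forall s, 0 < s -> m <= quot u s) -> m <= norm_deriv u.
Proof.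
move=> mP; apply: lb_le_inf; first by exists (quot u 1), 1 => //=.
by move=> _ [s s0 <-]; exact: mP.
Qed.

Let norm_derivD_le u v : norm_deriv (u + v) <= norm_deriv u + norm_deriv v.
Proof.
rewrite -lerBlDr; apply: le_norm_deriv => s s0; rewrite lerBlDr -lerBlDl.
apply: le_norm_deriv => r r0; rewrite lerBlDl.
(* With w = s r / (s + r), the point y + w (u + v) is a convex combination of
   y + s u and y + r v. *)
have w0 : 0 < s * r / (s + r) by rewrite divr_gt0 ?mulr_gt0 ?addr_gt0.
apply: le_trans (quot_le _ _ w0) _.
have sr0 : 0 < s + r by rewrite addr_gt0.
rewrite /quot.
have -> : y + (s * r / (s + r)) *: (u + v) =
    (s + r)^-1 *: (r *: (y + s *: u) + s *: (y + r *: v)).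
  rewrite !scalerDr !scalerA addrACA -!scalerDl; congr (_ + (_ + _)).
  - by rewrite -mulrDr (addrC r) mulVf ?gt_eqF// scale1r.
  - by congr (_ *: _); ring.
  - by congr (_ *: _); ring.
rewrite normrZ (gtr0_norm (_ : 0 < (s + r)^-1)) ?invr_gt0//.
have := ler_normD (r *: (y + s *: u)) (s *: (y + r *: v)).
rewrite !normrZ (gtr0_norm s0) (gtr0_norm r0).
set n := `|_ + _|; set a := `|y + _|; set b := `|y + _| => nab.
rewrite ler_pdivrMr//.
have -> : ((a - 1) / s + (b - 1) / r) * (s * r / (s + r)) =
    (s + r)^-1 * (r * a + s * b) - 1.
  by field; rewrite !gt_eqF.
by rewrite lerD2r ler_pM2l ?invr_gt0.
Qed.

Let norm_deriv0 : norm_deriv 0 = 0.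
Proof.
apply/eqP; rewrite eq_le; apply/andP; split.
  apply: le_trans (quot_le _ 1 _) _ => //.
  by rewrite /quot scaler0 addr0 y1 subrr mul0r.
apply: le_norm_deriv => s s0.
by rewrite /quot scaler0 addr0 y1 subrr mul0r.
Qed.

(** Sublinearity gives one inequality; the other one says that the norm has no
    corner at y, which is where smoothness is used. *)
Lemma norm_derivN u : norm_deriv (- u) = - norm_deriv u.
Proof.
apply/eqP; rewrite eq_le; apply/andP; split; last first.
  by have := norm_derivD_le u (- u); rewrite subrr norm_deriv0; lra.
rewrite -subr_le0 opprK; apply/ler_addgt0Pl => eps eps0; rewrite addr0.
have u0 : 0 < `|u| + 1 by have := normr_ge0 u; lra.
have [s /andP[s0 _] /(_ y (((`|u| + 1)^-1) *: u) y1)] :=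
  Ysmooth _ (divr_gt0 eps0 u0).
rewrite normrZ (gtr0_norm (_ : 0 < (`|u| + 1)^-1)) ?invr_gt0//.
rewrite mulrC ler_pdivrMr// mul1r lerDl => /(_ ler01).
rewrite !scalerA.
set r := s / (`|u| + 1) => sm; have r0 : 0 < r by rewrite divr_gt0.
apply: le_trans (lerD (quot_le _ _ r0) (quot_le _ _ r0)) _.
rewrite /quot -mulrDl ler_pdivrMr// scalerN.
have -> : eps * r = eps / (`|u| + 1) * s by rewrite /r; field; rewrite gt_eqF.
lra.
Qed.

Let norm_derivZ_le a u : 0 < a -> norm_deriv (a *: u) <= a * norm_deriv u.
Proof.
move=> a0; rewrite -ler_pdivrMl//; apply: le_norm_deriv => s s0.
rewrite ler_pdivrMl// (le_trans (quot_le _ _ (divr_gt0 s0 a0)))//.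
rewrite /quot scalerA divfK ?gt_eqF//.
by rewrite invfM invrK mulrA mulrC.
Qed.

Lemma norm_deriv_linear : linear (norm_deriv : Y -> R^o).
Proof.
have D u v : norm_deriv (u + v) = norm_deriv u + norm_deriv v.
  apply/eqP; rewrite eq_le norm_derivD_le/= -lerBrDr -norm_derivN.
  by rewrite -{1}(addrK v u) norm_derivD_le.
have Zgt0 a u : 0 < a -> norm_deriv (a *: u) = a * norm_deriv u.
  move=> a0; apply/eqP; rewrite eq_le norm_derivZ_le//=.
  rewrite -ler_pdivlMl// -{1}(scalerK (lt0r_neq0 a0) u).
  by rewrite norm_derivZ_le// invr_gt0.
move=> a u v; rewrite D; congr (_ + _); rewrite -[RHS]/(a * _).
have [a0|a0|<-] := ltgtP 0 a; first exact: Zgt0.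
- apply: oppr_inj; rewrite -norm_derivN -scaleNr Zgt0 ?oppr_gt0//.
  by rewrite mulNr.
- by rewrite scale0r norm_deriv0 mul0r.
Qed.

Lemma norm_deriv_le u : norm_deriv u <= `|u|.
Proof.
apply: le_trans (quot_le _ 1 _) _ => //; rewrite /quot scale1r divr1.
by rewrite lerBlDl -{1}y1 ler_normD.
Qed.

Lemma norm_deriv_self : norm_deriv y = 1.
Proof.
apply/eqP; rewrite eq_le -{1}y1 norm_deriv_le/=; apply: le_norm_deriv => s s0.
rewrite /quot -{1}(scale1r y) -scalerDl normrZ y1 mulr1 gtr0_norm ?addr_gt0//.
by rewrite addrC addKr divff// gt_eqF.
Qed.

End NormingFunctional.

(** * Bounded operators *)

Lemma bounded_op0 {R : realType} {E F : normedModType R} (f : bounded_op E F) :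
  f 0 = 0.
Proof. by have := bounded_op_linear f (-1) 0 0; rewrite !scaleN1r !addNr. Qed.

Lemma bounded_opZ {R : realType} {E F : normedModType R} (f : bounded_op E F)
  a x : f (a *: x) = a *: f x.
Proof. by have := bounded_op_linear f a x 0; rewrite bounded_op0 !addr0. Qed.

Lemma bounded_opN {R : realType} {E F : normedModType R} (f : bounded_op E F)
  x : f (- x) = - f x.
Proof. by rewrite -(scaleN1r x) bounded_opZ scaleN1r. Qed.

Lemma bounded_op_subE {R : realType} {E F : normedModType R}
  (f g : bounded_op E F) x : (f - g) x = f x - g x.
Proof. by []. Qed.

Lemma bounded_op_norm_le {R : realType} {E F : normedModType R}
  (f : bounded_op E F) (M : R) :
  (forall x, `|x| <= 1 -> `|f x| <= M) -> `|f| <= M.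
Proof. exact: opnorm_le. Qed.

Lemma ler_bounded_op_norm {R : realType} {E F : normedModType R}
  (f : bounded_op E F) x : `|f x| <= `|f| * `|x|.
Proof.
have [->|x0] := eqVneq x 0; first by rewrite bounded_op0 !normr0 mulr0.
have nx0 : 0 < `|x| by rewrite normr_gt0.
rewrite -ler_pdivrMr// mulrC -[X in X * _]gtr0_norm ?invr_gt0//.
rewrite -normrZ -bounded_opZ.
apply: opnorm_ub; rewrite normrZ gtr0_norm ?invr_gt0// mulVf//.
by rewrite gt_eqF.
Qed.

(** * Rank-one perturbations of the identity *)
Lemma norming_functional {R : realType} {Y : normedModType R} (y : Y) :
  uniformly_smooth Y -> `|y| = 1 ->
  exists2 phi : dual Y, phi y = 1 & `|phi| <= 1.
Proof.
move=> Ysmooth y1.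
have phi_lin := norm_deriv_linear y Ysmooth y1.
have phiP : (norm_deriv y : Y -> R^o) \in bounded_linear_pred (F := R^o).
  apply: mem_set; split=> //; exists 1 => u; rewrite mul1r.
  rewrite ler_norml norm_deriv_le// lerNl.
  by rewrite -norm_derivN// -normrN norm_deriv_le.
exists (BoundedOp phiP : dual Y); first exact: norm_deriv_self.
apply: bounded_op_norm_le => u u1; apply: le_trans u1.
rewrite ler_norml norm_deriv_le// andbT lerNl.
by rewrite -[X in X <= _]norm_derivN// -normrN norm_deriv_le.
Qed.

(** The value of t comes from smoothness with eps = 1/4, at the scale s that it
    provides: t - 1 = 2 / s rescales y - s (g / 2), whose norm is at most
    1 + s / 4, to a vector of norm at most (t - 1) + 1/2. *)
Lemma rank_one_reflection {R : realType} {Y : normedModType R} :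
  uniformly_smooth Y -> exists2 t : R, 1 < t &
    forall y : Y, `|y| = 1 -> exists phi : dual Y,
      [/\ phi y = 1, `|phi| <= 1 &
          forall u, `|u - (t * phi u) *: y| <= (t - 2^-1) * `|u|].
Proof.
move=> Ysmooth.
have [s /andP[s0 s1] sP] := Ysmooth 4^-1 ltac:(by rewrite invr_gt0).
have s2 : 2 <= 2 / s by rewrite ler_pdivlMr//; lra.
pose t := 1 + 2 / s; have t3 : 3 <= t by rewrite /t; lra.
exists t => [|y y1]; first lra.
have [phi phiy phi1] := norming_functional y Ysmooth y1.
have phi_le u : `|phi u| <= `|u|.
  by rewrite (le_trans (ler_bounded_op_norm _ _))// ler_piMl.
exists phi; split => // u.
have [->|u0] := eqVneq u 0.
  by rewrite bounded_op0 mulr0 scale0r subr0 normr0 mulr0.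
have nu0 : 0 < `|u| by rewrite normr_gt0.
(* The general case follows by homogeneity and, when [phi u < 0], by passing
   to [- u]. *)
suff unit_case v : `|v| = 1 -> 0 <= phi v ->
    `|v - (t * phi v) *: y| <= t - 2^-1.
  have unit_case' v : `|v| = 1 -> `|v - (t * phi v) *: y| <= t - 2^-1.
    move=> v1; have [phi_ge0|/ltW phi_le0] := leP 0 (phi v).
      exact: unit_case.
    have := unit_case (- v); rewrite normrN bounded_opN oppr_ge0 mulrN scaleNr.
    by rewrite -opprD normrN; exact.
  have -> : u = `|u| *: (`|u|^-1 *: u).
    by rewrite scalerA mulfV ?gt_eqF// scale1r.
  have : `| `|u|^-1 *: u| = 1.
    by rewrite normrZ gtr0_norm ?invr_gt0// mulVf ?gt_eqF.
  move: (`|u|^-1 *: u) => v v1.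
  rewrite bounded_opZ -[_ *: phi v]/(_ * phi v) mulrCA -scalerA -scalerBr.
  rewrite !normrZ normr_id v1 mulr1 mulrC.
  by rewrite ler_pM2r// unit_case'.
move=> v1 phi_ge0; have phiv1 : phi v <= 1.
  by rewrite -v1 (le_trans _ (phi_le v))// ler_norm.
set a := phi v in phi_ge0 phiv1 *.
pose g := v - a *: y.
have phig : phi g = 0.
  rewrite /g addrC -scaleNr (bounded_op_linear phi) phiy.
  by rewrite -[_ *: 1]/(- a * 1) mulr1 addNr.
have g2 : `|g| <= 2.
  by rewrite (le_trans (ler_normB _ _))// normrZ v1 y1 mulr1 ger0_norm//; lra.
(* The norm of y + s (g / 2) is at least its image 1 under phi, which leaves
   at most 1 + s / 4 for the other term. *)
have smooth : `|y - s *: (2^-1 *: g)| <= 1 + 4^-1 * s.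
  have h1 : `|2^-1 *: g| <= 1 by rewrite normrZ gtr0_norm ?invr_gt0//; lra.
  have := sP _ _ y1 h1.
  have : 1 <= `|y + s *: (2^-1 *: g)|.
    apply: le_trans (phi_le _); rewrite addrC scalerA.
    rewrite (bounded_op_linear phi (s * 2^-1) g y) phig phiy scaler0 add0r.
    by rewrite normr1.
  lra.
have far : `|g - (t - 1) *: y| <= t - 2^-1.
  have -> : g - (t - 1) *: y = - (2 / s) *: (y - s *: (2^-1 *: g)).
    rewrite scalerBr !scalerA [X in _ - X *: g](_ : _ = -1); last first.
      by field; rewrite gt_eqF.
    by rewrite scaleN1r opprK scaleNr addrC /t (addrC 1) addrK.
  rewrite normrZ normrN gtr0_norm ?divr_gt0//.
  apply: (@le_trans _ _ (2 / s * (1 + 4^-1 * s))).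
    by rewrite ler_wpM2l// divr_ge0// ltW.
  rewrite /t mulrDr mulr1 (_ : 2 / s * (4^-1 * s) = 2^-1); last first.
    by field; rewrite gt_eqF.
  lra.
have -> : v - (t * a) *: y = (1 - a) *: g + a *: (g - (t - 1) *: y).
  rewrite (scalerBr a g) addrA -scalerDl subrK scale1r /g.
  rewrite -addrA -opprD scalerA -scalerDl.
  by congr (_ - _ *: _); ring.
rewrite (le_trans (ler_normD _ _))// !normrZ (ger0_norm phi_ge0).
rewrite (ger0_norm (_ : 0 <= 1 - a)) ?subr_ge0//.
have := ler_wpM2l phi_ge0 far.
have := ler_wpM2l (_ : 0 <= 1 - a) g2; rewrite subr_ge0 => /(_ phiv1).
nra.
Qed.

Lemma rank_one_subproof {R : realType} {E Y : normedModType R}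
  (psi : dual E) (y : Y) :
  (fun u => psi u *: y) \in bounded_linear_pred (E := E) (F := Y).
Proof.
apply: mem_set; split.
  move=> a u v; rewrite /= bounded_op_linear.
  by rewrite -[_ + _]/(a * psi u + psi v) scalerDl scalerA.
exists (`|psi| * `|y|) => u.
by rewrite normrZ mulrAC ler_wpM2r// ler_bounded_op_norm.
Qed.

Definition rank_one {R : realType} {E Y : normedModType R}
  (psi : dual E) (y : Y) : bounded_op E Y :=
  BoundedOp (rank_one_subproof psi y).

Lemma rank_one_finite_rank {R : realType} {E Y : normedModType R}
  (psi : dual E) (y : Y) : finite_rank (rank_one psi y).
Proof.
exists 1, (fun=> y) => u; exists (fun=> psi u).
by rewrite big_ord_recl big_ord0 addr0.
Qed.

Lemma rank_one_dist_le {R : realType} {E Y : normedModType R}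
  (psi psi' : dual E) (y y' : Y) :
  `|rank_one psi y - rank_one psi' y'| <=
    `|psi - psi'| * `|y| + `|psi'| * `|y - y'|.
Proof.
apply: bounded_op_norm_le => u u1.
have -> : (rank_one psi y - rank_one psi' y') u =
    (psi - psi') u *: y + psi' u *: (y - y').
  rewrite bounded_op_subE scalerBr scalerBl addrA subrK.
  by [].
rewrite (le_trans (ler_normD _ _))// !normrZ lerD// ler_wpM2r//.
  by rewrite (le_trans (ler_bounded_op_norm _ _))// ler_piMr.
by rewrite (le_trans (ler_bounded_op_norm _ _))// ler_piMr.
Qed.

Lemma pullback_subproof {R : realType} {E Y : normedModType R}
  (phi : dual Y) (f : bounded_op E Y) :
  (fun u => phi (f u)) \in bounded_linear_pred (E := E) (F := R^o).
Proof.
apply: mem_set; split.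
  by move=> a u v; rewrite /= !bounded_op_linear.
exists (`|phi| * `|f|) => u; rewrite (le_trans (ler_bounded_op_norm _ _))//.
by rewrite -mulrA ler_wpM2l// ler_bounded_op_norm.
Qed.

Definition pullback {R : realType} {E Y : normedModType R}
  (phi : dual Y) (f : bounded_op E Y) : dual E :=
  BoundedOp (pullback_subproof phi f).

(** * Coverings of the unit sphere *)
Lemma dense_dist {R : realType} {V : normedModType R} (D : set V)
  (x : V) (e : R) :
  dense D -> 0 < e -> exists2 d, D d & `|x - d| < e.
Proof.
move=> D_dense e0; have [||d []] := D_dense (ball x e).
- by exists x; exact: ballxx.
- exact: ball_open.
by rewrite -ball_normE /ball_/= => xd Dd; exists d.
Qed.

(** Only the members of D of norm at least r + delta may serve as centers. The
    existence of a unit vector in Z ensures that there is one, so that a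
    sequence can enumerate them. *)
Lemma UBCP_of_countable_approx {R : realType} {V : normedModType R}
  (Z D : set V) (r delta : R) : Z 0 -> 0 < r -> 0 < delta ->
  (forall a z, Z z -> Z (a *: z)) -> countable D -> D `<=` Z ->
  (forall x, Z x -> `|x| = 1 ->
    exists2 d, D d & `|x - d| < r /\ r + delta <= `|d|) ->
  UBCP Z.
Proof.
move=> Z0 r0 delta0 ZZ D_count DZ approx.
have [[x Zx x0]|Z_eq0] := pselect (exists2 x, Z x & x != 0); last first.
  left; apply/seteqP; split=> [x Zx /=|_ ->//].
  by apply: contrapT => /eqP x0; apply: Z_eq0; exists x.
pose C := D `&` [set d | r + delta <= `|d|].
have [d0 Cd0] : C !=set0.
  have [||d Dd [_ d_far]] := approx (`|x|^-1 *: x); [exact: ZZ| |by exists d].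
  by rewrite normrZ normfV normr_id mulVf// normr_eq0.
have C_count : countable C.
  by apply: sub_countable D_count; apply: subset_card_le => ? [].
right; have [C0|[z]] := pfcard_geP C_count; first by rewrite C0 in Cd0.
have Cz j : C (z j) by exact: funS.
exists r, z; split=> //.
- by move=> j; exact/DZ/(Cz j).1.
- move=> y [Zy y1]; have [d Dd [yd d_far]] := approx _ Zy y1.
  have [j _ zj] : (z @` setT) d by rewrite image_eq.
  by exists j => //; rewrite -ball_normE /ball_/= zj distrC.
- apply: (@lt_le_trans _ _ (r + delta)); first by rewrite ltrDl.
  apply: lb_le_inf; first by exists `|z 0%N|, 0%N.
  by move=> _ [j _ <-]; exact: (Cz j).2.
Qed.

(** The ideal center S = t (phi o f) (x) y satisfies `|f - S| <= t - 1/2 and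
    `|S| >= t - 1/8. Its approximation S' in the countable family is at distance
    less than 1/16, so that `|f - S'| < t - 7/16 and `|S'| > t - 3/16; the
    radius t - 3/8 and the margin 1/8 separate these two values. *)
Theorem UBCP_uniformly_smooth {R : realType} {E Y : normedModType R}
  (Z : set (bounded_op E Y)) :
  uniformly_smooth Y -> separable Y -> separable (dual E) ->
  submod_closed (mem Z) -> @finite_rank R E Y `<=` Z -> UBCP Z.
Proof.
move=> Ysmooth [DY DY_count DY_dense] [DE DE_count DE_dense] [Z0 Zlin] Zfin.
have [t t1 refl] := rank_one_reflection Ysmooth.
have ZZ a z : Z z -> Z (a *: z).
  move=> Zz; have := Zlin a z 0 (mem_set Zz) Z0.
  by rewrite addr0 => /set_mem.
pose D := (fun c => rank_one c.1 c.2) @` (DE `*` DY).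
apply: (@UBCP_of_countable_approx _ _ Z D (t - 3/8) (1/8)) => //.
- exact: set_mem Z0.
- lra.
- lra.
- by apply: sub_countable (card_image_le _ _) _; exact: countableX.
- by move=> _ [c _ <-]; apply: Zfin; exact: rank_one_finite_rank.
move=> f _ f1.
have [_ [x /= x1 <-]] : exists2 a,
    [set `|f x| | x in [set x : E | `|x| <= 1]] a &
    1 - (8 * t)^-1 < a.
  apply: sup_gt; first by exists `|f 0|, 0 => //=; rewrite normr0.
  by rewrite -bounded_op_normE f1 ltrBlDr ltrDl invr_gt0; lra.
have t8 : t * (8 * t)^-1 = 8^-1 by field; rewrite gt_eqF//; lra.
have t8_1 : (8 * t)^-1 < 1 by rewrite invf_lt1; lra.
move=> fx_gt; have fx0 : 0 < `|f x| by lra.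
pose y := `|f x|^-1 *: f x.
have y1 : `|y| = 1 by rewrite normrZ normfV normr_id mulVf// gt_eqF.
have [phi [phiy phi1 phi_refl]] := refl y y1.
pose psi := t *: pullback phi f.
have e0 : 0 < 32^-1 :> R by rewrite invr_gt0.
have [psi' DEpsi' dpsi] := dense_dist DE psi _ DE_dense e0.
have e1 : 0 < (32 * (`|psi'| + 1))^-1.
  by rewrite invr_gt0; have := normr_ge0 psi'; lra.
have [y' DYy' dy] := dense_dist DY y _ DY_dense e1.
exists (rank_one psi' y'); first by exists (psi', y').
have approx : `|rank_one psi y - rank_one psi' y'| < 16^-1.
  apply: le_lt_trans (rank_one_dist_le _ _ _ _) _; rewrite y1 mulr1.
  have psi'0 : 0 < `|psi'| + 1 by have := normr_ge0 psi'; lra.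
  have : `|psi'| * `|y - y'| <= 32^-1.
    apply: (@le_trans _ _ ((`|psi'| + 1) * (32 * (`|psi'| + 1))^-1)).
      by rewrite ler_pM ?(ltW dy)// lerDl.
    by rewrite invfM mulrCA mulfV ?gt_eqF// mulr1.
  lra.
have f_near : `|f - rank_one psi y| <= t - 2^-1.
  apply: bounded_op_norm_le => u u1.
  rewrite bounded_op_subE -[rank_one _ _ _]/((t * phi (f u)) *: y).
  rewrite (le_trans (phi_refl _))// ler_piMr//; first lra.
  by rewrite (le_trans (ler_bounded_op_norm _ _))// f1 mul1r.
have far : t - 8^-1 <= `|rank_one psi y|.
  apply: le_trans (opnorm_ub (rank_one psi y) x1).
  rewrite -[rank_one _ _ _]/((t * phi (f x)) *: y) normrZ y1 mulr1.
  have -> : f x = `|f x| *: y by rewrite scalerA mulfV ?gt_eqF// scale1r.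
  rewrite bounded_opZ phiy -[_ *: 1]/(_ * 1) mulr1 normrM normr_id.
  rewrite (gtr0_norm (_ : 0 < t)); last lra.
  have := ler_wpM2l (_ : 0 <= t) (ltW fx_gt).
  by rewrite mulrBr t8 mulr1 => -> //; lra.
split.
- rewrite -(subrKA (rank_one psi y)) (le_lt_trans (ler_normD _ _))//; lra.
- have := lerB_dist (rank_one psi y) (rank_one psi' y'); lra.
Qed.

Theorem corollary1p3 (R : realType) (d : measure_display)
  (T : measurableType d) (mu : {measure set T -> \bar R})
  (p : \bar R) (p_gt1 : (1 < p)%E) (p_fin : (p < +oo)%E)
  (Y_separable : separable (LspaceType mu (ltW p_gt1)))
  (E : completeNormedModType R) (E_dual_separable : separable (dual E))
  (Z : set (bounded_op E (LspaceType mu (ltW p_gt1))))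
  (Z_subspace : submod_closed (mem Z)) (Z_closed : closed Z)
  (Z_finite_rank : @finite_rank R E (LspaceType mu (ltW p_gt1)) `<=` Z) :
  UBCP Z.
Proof.
apply: UBCP_uniformly_smooth => //.
exact: Lspace_uniformly_smooth p_gt1 p_fin.
Qed.
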